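(* Suppose $D$ is the center of an $A_4^8(1)$-polytope in $4_{21}$. Then there is a line $l\in L_8$ such that all the $A_4^8(1)$-polytopes in $4_{21}$ with center $D$ contain $l$, and $D-l$ is the common center of the unique cornered $A_3^8(1)$-polytope contained in each $A_4^8(1)$-polytope with center $D$.
   Context: $S_8$ is a del Pezzo surface obtained by blowing up $\mathbb{P}^2$ at $8$ points (with $-K_{S_8}$ ample). $\mathrm{Pic}\,S_8=\mathbb{Z}h\oplus\mathbb{Z}e_1\oplus\dots\oplus\mathbb{Z}e_8$ with intersection form $h^2=1$, $h\cdot e_i=0$, $e_i\cdot e_j=-\delta_{ij}$, and $K_{S_8}=-3h+\sum_{i=1}^8 e_i$. A line is a class $l\in\mathrm{Pic}\,S_8$ with $l^2=l\cdot K_{S_8}=-1$; $L_8$ is the set of lines, which is the vertex set of the Gosset polytope $4_{21}$ (the convex hull of $L_8$). An $A_n^8(1)$-polytope in $4_{21}$ is a set of $n+1$ distinct lines in $L_8$ with pairwise intersection number $1$; its center is the sum of these lines. The vertex figure of $l\in L_8$ is $\{l'\in L_8: l'\cdot l=0\}$. An $A_n^8(1)$-polytope is cornered if there is a line $l\in L_8$ whose vertex figure contains all its lines. Every $A_4^8(1)$-polytope contains a unique four-element subset that is a cornered $A_3^8(1)$-polytope. *)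

(* Defs.v *)
From HB Require Import structures.
From mathcomp Require Import all_boot all_order all_algebra finmap.

Set Implicit Arguments.
Unset Strict Implicit.
Unset Printing Implicit Defensive.

Import Order.TTheory GRing.Theory Num.Theory.
Local Open Scope ring_scope.

(* Pic S_8 = Zh + Ze_1 + ... + Ze_8 in coordinates: entry 0 is the coefficient
   of h and entry i.+1 that of e_(i+1).  The surface enters only through this
   lattice and its canonical class, which do not depend on the 8 points. *)
Definition pic := 'rV[int]_9.

Definition h : pic := delta_mx 0 0.
Definition e (i : 'I_8) : pic := delta_mx 0 (lift ord0 i).

Definition dot (x y : pic) : int :=
  x 0 0 * y 0 0 - \sum_(i < 8) x 0 (lift ord0 i) * y 0 (lift ord0 i).

Definition K : pic := - (h *+ 3) + \sum_(i < 8) e i.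

Definition L8 : {pred pic} := [pred l | (dot l l == -1) && (dot l K == -1)].

Definition vertex_figure (l : pic) : {pred pic} :=
  [pred l' | (l' \in L8) && (dot l' l == 0)].

(* A_n^8(1)-polytopes, given by their vertex sets. *)
Definition A1_polytope (n : nat) (P : {fset pic}) : Prop :=
  [/\ #|` P| = n.+1,
      {subset P <= L8}
    & {in P &, forall l l', l != l' -> dot l l' = 1}].

Definition center (P : {fset pic}) : pic := \sum_(l <- P) l.

Definition cornered_A1_polytope (n : nat) (P : {fset pic}) : Prop :=
  A1_polytope n P /\ exists2 l, l \in L8 & {subset P <= vertex_figure l}.

Lemma pic_decomp (x : pic) :
  x = h *~ x 0 0 + \sum_(i < 8) e i *~ x 0 (lift ord0 i).
Proof.
rewrite [LHS]row_sum_delta big_ord_recl /=.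
by congr (_ + _); [|apply: eq_bigr => i _]; rewrite -scaler_int intz.
Qed.

Lemma dot_hh : dot h h = 1.
Proof. by rewrite /dot big1 ?mxE // => i _; rewrite !mxE mulr0. Qed.

Lemma dot_he i : dot h (e i) = 0.
Proof. by rewrite /dot big1 ?mxE // => j _; rewrite !mxE mul0r. Qed.

Lemma dot_ee i j : dot (e i) (e j) = - (i == j)%:R.
Proof.
rewrite /dot !mxE /= mul0r sub0r (bigD1 i) //= big1 => [|k ki].
  by rewrite !mxE !(inj_eq lift_inj) !eqxx mul1r addr0.
by rewrite !mxE !(inj_eq lift_inj) (negPf ki) mul0r.
Qed.

(* Main.v *)
Require Import Defs.
From HB Require Import structures.
From mathcomp Require Import all_boot all_order all_algebra finmap.
From mathcomp Require Import zify ring.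

Set Implicit Arguments.
Unset Strict Implicit.
Unset Printing Implicit Defensive.

Import Order.TTheory GRing.Theory Num.Theory.
Local Open Scope ring_scope.

(** Sending a line [l] to [l + K] identifies the lines with the roots of the
    lattice [K^perp], which is even and negative definite (it is E8 with the
    opposite sign).  As [K . K = 1], this lowers every intersection number of
    two lines by 1, so lines meeting once are orthogonal roots and an
    [A_4(1)]-polytope is a set of five mutually orthogonal roots.

    Four orthogonal roots form a cornered polytope exactly when their sum is
    twice a root [r].  If a line [m] has product 0 with all four lines, then
    [m + K] has product -1 with the four roots; the difference between their
    sum and [2 (m + K)] has norm 0, and it vanishes by definiteness
    ([cornered_sum_root]).  Conversely, half of the sum, if it lies in the
    lattice, is a root and its line is a corner.

    Such a quadruple exists among any five orthogonal roots: modulo 2 they span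
    a totally isotropic subspace of [F_2^9], whose dimension is at most 4, so
    some nonempty subset has a sum of the form [2 x] ([even_orth_subset]).
    The norm of [x] is minus half the size of this subset and is even, so the
    size is 4 ([cornered_subpolytope]).

    Hence the roots of any [A_4(1)]-polytope sum to [2 r + s], with [r] a root
    orthogonal to [s] and [s] the root of the line outside a cornered quadruple
    ([cornered_complement]).  The vector [2 r + s] determines [s]
    ([root_sum_inj]).  Applied to two quadruples in one polytope this shows that
    the cornered quadruple is unique; applied to two polytopes with the same
    center it shows that the omitted line [l] is the same, and the quadruple
    then has center [D - l]. *)

Lemma sumr_const_fset (T : choiceType) (V : nmodType) (A : {fset T}) (x : V) :
  \sum_(i <- A) x = x *+ #|` A|.
Proof. by rewrite big_const_seq count_predT -Monoid.iteropE. Qed.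

(** * The intersection form on the Picard lattice *)

Lemma dotC x y : dot x y = dot y x.
Proof.
by rewrite /dot mulrC; congr (_ - _); apply: eq_bigr => i _; rewrite mulrC.
Qed.

Lemma dot_is_zmod_morphism x : zmod_morphism (dot x).
Proof.
move=> y z; rewrite /dot !mxE (eq_bigr (fun i : 'I_8 =>
  x 0 (lift ord0 i) * y 0 (lift ord0 i) - x 0 (lift ord0 i) * z 0 (lift ord0 i))).
  by rewrite sumrB; ring.
by move=> i _; rewrite !mxE mulrBr.
Qed.

HB.instance Definition _ x :=
  GRing.isZmodMorphism.Build pic int (dot x) (dot_is_zmod_morphism x).

Lemma dotDr x y z : dot x (y + z) = dot x y + dot x z.
Proof. exact: raddfD. Qed.

Lemma dotDl x y z : dot (y + z) x = dot y x + dot z x.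
Proof. by rewrite !(dotC _ x) dotDr. Qed.

Lemma dotNr x y : dot x (- y) = - dot x y.
Proof. exact: raddfN. Qed.

Lemma dotNl x y : dot (- y) x = - dot y x.
Proof. by rewrite !(dotC _ x) dotNr. Qed.

Lemma dotMnr x y n : dot x (y *+ n) = dot x y *+ n.
Proof. exact: raddfMn. Qed.

Lemma dotMnl x y n : dot (y *+ n) x = dot y x *+ n.
Proof. by rewrite !(dotC _ x) dotMnr. Qed.

Definition dotE := (dotDl, dotDr, dotNl, dotNr, dotMnl, dotMnr).

Lemma dotKE x : dot x K = - (3 * x 0 0) - \sum_(i < 8) x 0 (lift ord0 i).
Proof.
rewrite /K dotDr dotNr dotMnr raddf_sum /=.
have -> : dot x h = x 0 0.
  by rewrite /dot big1 ?mxE ?mulr1 ?subr0 // => i _; rewrite !mxE mulr0.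
rewrite -sumrN; congr (_ + _); first by ring.
apply: eq_bigr => i _; rewrite /dot !mxE /= mulr0 sub0r (bigD1 i) //= big1.
  by rewrite !mxE !eqxx mulr1 addr0.
by move=> j ji; rewrite !mxE !(inj_eq lift_inj) (negPf ji) mulr0.
Qed.

Lemma dotKK : dot K K = 1.
Proof.
have K0 : K 0 0 = - 3.
  by rewrite /K !mxE summxE big1 // => i _; rewrite !mxE.
have Ki i : K 0 (lift ord0 i) = 1.
  rewrite /K !mxE summxE (bigD1 i) //= big1 ?mxE ?eqxx //.
  by move=> j ji; rewrite !mxE (inj_eq lift_inj) eq_sym (negPf ji).
by rewrite dotKE K0 (eq_bigr (fun=> 1)) // sumr_const card_ord.
Qed.

(** [K] is a characteristic vector of the lattice, since all its coordinates
    are odd; hence [K^perp] is even. *)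
Lemma dvd2_dot_selfK x : (2 %| dot x x - dot x K)%Z.
Proof.
have sq (a : int) : (2 %| a * a - a)%Z.
  apply/dvdzP; have := divz_eq a 2; set q := (a %/ 2)%Z.
  have [-> a2|-> a2] : (a %% 2)%Z = 0 \/ (a %% 2)%Z = 1 by lia.
    by exists (q * (2 * q - 1)); rewrite a2; ring.
  by exists ((2 * q + 1) * q); rewrite a2; ring.
have -> : dot x x - dot x K = (x 0 0 * x 0 0 - x 0 0) + 2 * (2 * x 0 0)
   - \sum_(i < 8) (x 0 (lift ord0 i) * x 0 (lift ord0 i) - x 0 (lift ord0 i)).
  by rewrite dotKE /dot sumrB; ring.
rewrite rpredB ?rpred_sum //.
by rewrite rpredD // dvdz_mulr.
Qed.

(** The identity behind the negative definiteness of [K^perp]: there the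
    coordinates along the [e i] sum to [-3] times the one along [h], which
    turns the cross terms of the squares into a multiple of the first
    coordinate's square. *)
Lemma dot_self_squares x : dot x K = 0 ->
  - (9 * dot x x) =
    x 0 0 ^+ 2 + \sum_(i < 8) (3 * x 0 (lift ord0 i) + x 0 0) ^+ 2.
Proof.
rewrite dotKE => xK.
rewrite (eq_bigr (fun i : 'I_8 =>
  9 * (x 0 (lift ord0 i) * x 0 (lift ord0 i)) + 6 * x 0 0 * x 0 (lift ord0 i)
   + x 0 0 ^+ 2)); last by move=> i _; ring.
rewrite !big_split /= -!mulr_sumr sumr_const card_ord /dot.
have -> : \sum_(i < 8) x 0 (lift ord0 i) = - (3 * x 0 0) by lia.
ring.
Qed.

Lemma dot_self_le0 x : dot x K = 0 -> dot x x <= 0.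
Proof.
move=> /dot_self_squares xx.
suff : 0 <= - (9 * dot x x) by lia.
by rewrite xx addr_ge0 ?sqr_ge0 // sumr_ge0 // => i _; apply: sqr_ge0.
Qed.

Lemma dot_self_eq0 x : dot x K = 0 -> dot x x = 0 -> x = 0.
Proof.
move=> /dot_self_squares + xx; rewrite xx mulr0 oppr0 => /esym/eqP.
have sq_ge0 (i : 'I_8) : true -> 0 <= (3 * x 0 (lift ord0 i) + x 0 0) ^+ 2.
  by move=> _; apply: sqr_ge0.
rewrite paddr_eq0 ?sqr_ge0 ?sumr_ge0 // sqrf_eq0 => /andP[/eqP x0].
rewrite psumr_eq0 // => /allP xi0.
apply/rowP => j; rewrite mxE; case: (unliftP ord0 j) => [i|] -> //.
have := xi0 i (mem_index_enum i); rewrite sqrf_eq0 x0 addr0 mulf_eq0.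
by move/eqP.
Qed.

(** * Lines as roots *)

Definition line_root (l : pic) : pic := l + K.

Lemma dot_rootK l : l \in L8 -> dot (line_root l) K = 0.
Proof. by case/andP=> _ /eqP lK; rewrite dotDl lK dotKK. Qed.

Lemma dot_root l l' : l \in L8 -> l' \in L8 ->
  dot (line_root l) (line_root l') = dot l l' - 1.
Proof.
case/andP=> _ /eqP lK /andP[_ /eqP l'K].
(* With [K] generalized, the expansion by bilinearity does not unfold it. *)
rewrite /line_root; move: K lK l'K dotKK => k lk l'k kk.
by rewrite !dotE (dotC k) lk l'k kk; ring.
Qed.

Lemma dot_root_self l : l \in L8 -> dot (line_root l) (line_root l) = - 2.
Proof. by move=> lL; rewrite dot_root //; case/andP: lL => /eqP ->. Qed.

Lemma line_of_root x : dot x K = 0 -> dot x x = - 2 -> x - K \in L8.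
Proof.
move=> xK xx; apply/andP; move: K xK dotKK => k xk kk.
by rewrite !dotE (dotC k) xk xx kk.
Qed.

Lemma sum_root (P : {fset pic}) :
  \sum_(l <- P) line_root l = center P + K *+ #|` P|.
Proof. by rewrite big_split /= sumr_const_fset. Qed.

(** Put [y = r - r'], so that [s' = s + 2 y], and let [n = - y . y].  The norms of
    [r'] and [s'] force [y . r = - n / 2] and [y . s = n]; then [2 (y + s) - r]
    has norm [6 n - 10], which definiteness requires to be nonpositive.  Since
    [n] is even and nonnegative, [n = 0]. *)
Lemma root_sum_inj r s r' s' :
    dot r K = 0 -> dot r r = - 2 -> dot s K = 0 -> dot s s = - 2 ->
    dot r s = 0 ->
    dot r' K = 0 -> dot r' r' = - 2 -> dot s' s' = - 2 ->
    r *+ 2 + s = r' *+ 2 + s' ->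
  s = s'.
Proof.
move=> rK rr sK ss rs r'K r'r' s's' E.
pose y := r - r'.
have Er : r' = r - y by rewrite /y opprB addrC subrK.
have Es : s' = s + y *+ 2.
  apply: (addrI (r' *+ 2)); rewrite -E /y mulrnBl addrCA.
  by rewrite [X in s + X]addrC subrK addrC.
have yK : dot y K = 0 by rewrite dotDl dotNl rK r'K.
clearbody y.
have /dot_self_le0 z_le0 : dot ((y + s) *+ 2 - r) K = 0.
  by rewrite dotDl dotMnl dotDl dotNl yK sK rK.
have := dvd2_dot_selfK y; have := dot_self_le0 yK; rewrite yK.
move: r'r' s's' z_le0; rewrite Er Es !dotE (dotC y s) (dotC y r) (dotC s r).
rewrite rr ss rs => *.
have yy : dot y y = 0 by lia.
by rewrite (dot_self_eq0 yK yy) mul0rn addr0.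
Qed.

(** The sum [w] of the roots has norm -8 and product -4 with the root [r] of [m],
    so [w - 2 r] has norm [-8 + 16 - 8 = 0]. *)
Lemma cornered_sum_root (Q : {fset pic}) m :
    A1_polytope 3 Q -> m \in L8 -> {subset Q <= vertex_figure m} ->
  \sum_(l <- Q) line_root l = line_root m *+ 2.
Proof.
move=> [cardQ QL Q1] mL Qm; set w := \sum_(l <- Q) _.
have wK : dot w K = 0.
  rewrite dotC raddf_sum big_seq big1 // => l lQ /=.
  by rewrite dotC dot_rootK ?QL.
have wl l : l \in Q -> dot w (line_root l) = - 2.
  move=> lQ; rewrite dotC raddf_sum (big_fsetD1 l) //= dot_root_self ?QL //.
  rewrite big_seq big1 ?addr0 // => l'; rewrite !inE => /andP[l'l l'Q].
  by rewrite dot_root ?QL // Q1 // eq_sym.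
have sum_const c : \sum_(l <- Q) c = c *+ 4 :> int.
  by rewrite sumr_const_fset cardQ.
have ww : dot w w = - 8.
  by rewrite {2}/w raddf_sum big_seq (eq_bigr (fun=> - 2)) // -big_seq sum_const.
have wm : dot w (line_root m) = - 4.
  rewrite dotC raddf_sum big_seq (eq_bigr (fun=> - 1)) -?big_seq ?sum_const //.
  move=> l lQ /=; have /andP[lL /eqP lm] := Qm _ lQ.
  by rewrite dot_root // dotC lm.
clearbody w; move: (line_root m) (dot_root_self mL) (dot_rootK mL) wm => r rr rK wr.
apply/eqP; rewrite -subr_eq0; apply/eqP/dot_self_eq0.
  by rewrite dotDl dotNl dotMnl wK rK.
by rewrite !dotE (dotC r w) wr ww rr.
Qed.

(** * Reduction modulo 2 *)

Lemma intr_F2_eq0 (n : int) : (n%:~R == 0 :> 'F_2) = (2 %| n)%Z.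
Proof. by rewrite -(dvdz_pcharf (pchar_Fp (isT : prime 2))). Qed.

Lemma half_pic (w : pic) :
  (forall j, (w 0 j)%:~R = 0 :> 'F_2) -> exists x, w = x *+ 2.
Proof.
move=> w0; exists (\row_j divz (w 0 j) 2); apply/rowP => j.
have /eqP := w0 j; rewrite intr_F2_eq0 mulr2n !mxE => /divzK {1}<-.
by ring.
Qed.

(** Modulo 2 the signs disappear and the intersection form becomes the standard
    dot product, so that Gram matrices are products [A *m A^T]. *)
Lemma dot_F2 x y :
  (dot x y)%:~R = \sum_j (x 0 j)%:~R * (y 0 j)%:~R :> 'F_2.
Proof.
have F2 : 2%N \in [pchar 'F_2] by rewrite pchar_Fp.
rewrite /dot rmorphB rmorphM rmorph_sum (oppr_pchar2 F2) [RHS]big_ord_recl /=.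
by congr (_ + _); apply: eq_bigr => i _; rewrite rmorphM.
Qed.

(** If [A] has the reductions modulo 2 of the vectors as rows, then
    [A *m A^T = 0], so the rank of [A] is at most half of 9, that is 4.  More
    than four rows are therefore dependent, and over [F_2] a dependency is a
    subset with zero sum. *)
Lemma even_orth_subset (P : {fset pic}) (f : pic -> pic) :
    (4 < #|` P|)%N -> {in P &, forall x y, (2 %| dot (f x) (f y))%Z} ->
  exists Q : {fset pic}, [/\ (Q `<=` P)%fset, Q != fset0
    & exists x, \sum_(l <- Q) f l = x *+ 2].
Proof.
move=> P4 P_even; pose n := size P.
pose A : 'M['F_2]_(n, 9) := \matrix_(i, j) (f P`_i 0 j)%:~R.
have A_iso : A *m A^T = 0.
  apply/matrixP => i j; rewrite !mxE; apply/eqP.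
  rewrite (eq_bigr (fun k => (f P`_i 0 k)%:~R * (f P`_j 0 k)%:~R)).
    by rewrite -dot_F2 intr_F2_eq0 P_even // mem_nth.
  by move=> k _; rewrite !mxE.
have rkA : (\rank A <= 4)%N.
  by have := mulmx0_rank_max A_iso; rewrite mxrank_tr; lia.
have /rowV0Pn[u /sub_kermxP uA u0] : kermx A != 0.
  by rewrite kermx_eq0 -row_leq_rank -ltnNge (leq_ltn_trans rkA).
pose support (l : pic) : bool :=
  if insub (index l P) is Some i then u 0 (i : 'I_n) != 0 else false.
have supportE (i : 'I_n) : support P`_i = (u 0 i != 0).
  by rewrite /support index_uniq ?fset_uniq // valK.
exists [fset l in P | support l]%fset; split; first exact: fset_sub.
  have /rV0Pn[i ui] := u0; apply/fset0Pn; exists P`_i.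
  by rewrite !inE supportE ui mem_nth.
apply: half_pic => j.
transitivity ((u *m A) 0 j); last by rewrite uA mxE.
rewrite -big_fset_condE /= summxE rmorph_sum (big_nth 0) big_mkord mxE /=.
rewrite big_mkcond; apply: eq_bigr => i _; rewrite mxE supportE.
have [->|u1] := eqVneq (u 0 i) 0; first by rewrite mul0r.
suff -> : u 0 i = 1 by rewrite mul1r.
by move: u1; case: (u 0 i) => -[|[|m]] lt_m2 // _; apply: val_inj.
Qed.

(** * Cornered quadruples in a polytope *)

(** A subset of the roots with sum [2 x] has a size divisible by 4, because the
    norm of [x] is even; the upper bound on [n] excludes subsets of size 8, for
    which [x] would have norm -4 and not be a root. *)
Lemma cornered_subpolytope (n : nat) (P : {fset pic}) :
    A1_polytope n P -> (3 < n < 7)%N ->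
  exists2 Q, cornered_A1_polytope 3 Q & (Q `<=` P)%fset.
Proof.
move=> [cardP PL P1] n47.
have rootP l l' : l \in P -> l' \in P ->
    dot (line_root l) (line_root l') = if l == l' then - 2 else 0.
  move=> lP l'P; have [->|ll'] := eqVneq; first by rewrite dot_root_self ?PL.
  by rewrite dot_root ?PL // P1.
have [|l l' lP l'P|Q [QP Q0 [x Qx]]] := @even_orth_subset P line_root.
- by rewrite cardP; lia.
- by rewrite rootP //; case: eqVneq.
have QsP := fsubsetP QP.
have xK : dot x K = 0.
  have : dot (x *+ 2) K = 0.
    rewrite -Qx dotC raddf_sum big_seq big1 // => l lQ /=.
    by rewrite dotC dot_rootK ?PL ?QsP.
  by rewrite dotMnl; lia.
have xl l : l \in Q -> dot x (line_root l) = - 1.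
  move=> lQ; have : dot (x *+ 2) (line_root l) = - 2.
    rewrite -Qx dotC raddf_sum (big_fsetD1 l) //= rootP ?QsP // eqxx.
    rewrite big_seq big1 ?addr0 // => l'; rewrite !inE => /andP[l'l l'Q].
    by rewrite rootP ?QsP // eq_sym (negPf l'l).
  by rewrite dotE; lia.
have xx : dot x x *+ 2 = - (#|` Q|%:Z).
  rewrite -dotMnr -Qx raddf_sum big_seq (eq_bigr (fun=> - 1)) // -big_seq.
  by rewrite sumr_const_fset; lia.
have cardQ : #|` Q| = 4%N.
  have := dvd2_dot_selfK x; have := fsubset_leq_card QP.
  have : #|` Q| != 0%N by rewrite cardfs_eq0.
  by rewrite cardP xK; lia.
have mL : x - K \in L8 by apply: line_of_root => //; lia.
exists Q => //; split; first split=> //.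
- by move=> l lQ; rewrite PL ?QsP.
- by move=> l l' lQ l'Q; apply: P1; rewrite QsP.
exists (x - K) => // l lQ; have lL : l \in L8 by rewrite PL ?QsP.
apply/andP; split=> //.
have := dot_root lL mL; rewrite [line_root (x - K)]subrK dotC xl //; lia.
Qed.

(** The decomposition [2 r + s] of the sum of the five roots to which
    [root_sum_inj] applies. *)
Lemma cornered_complement (P Q : {fset pic}) :
    A1_polytope 4 P -> cornered_A1_polytope 3 Q -> (Q `<=` P)%fset ->
  exists l, [/\ l \in P, Q = (P `\ l)%fset, center P = l + center Q &
    exists r, [/\ dot r K = 0, dot r r = - 2, dot r (line_root l) = 0
                & center P + K *+ 5 = r *+ 2 + line_root l]].
Proof.
move=> [cardP PL P1] [QA [m mL Qm]] QP.
have cardQ : #|` Q| = 4%N by case: QA.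
have /cardfs1P[l PQ] : #|` P `\` Q|%fset == 1%N.
  by rewrite cardfsD (fsetIidPr QP) cardP cardQ.
have [lP lQ] : l \in P /\ l \notin Q.
  by have := fset11 l; rewrite -PQ !inE => /andP[].
have QE : Q = (P `\ l)%fset by rewrite -PQ fsetDK.
exists l; split=> //; first by rewrite {1}/center (big_fsetD1 l) //= -QE.
have Qsum := cornered_sum_root QA mL Qm.
exists (line_root m); split; rewrite ?dot_rootK ?dot_root_self //.
- have : dot (line_root l) (line_root m *+ 2) = 0.
    rewrite -Qsum raddf_sum big_seq big1 // => l' l'Q /=.
    have l'P := fsubsetP QP _ l'Q.
    rewrite dot_root ?PL // P1 //.
    by apply: contraNneq lQ => ->.
  by rewrite dotE dotC; lia.
- have := sum_root P; rewrite cardP => <-.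
  by rewrite (big_fsetD1 l) //= -QE Qsum addrC.
Qed.

Theorem theorem22 (D : pic) :
  (exists2 P : {fset pic}, A1_polytope 4 P & center P = D) ->
  exists2 l : pic, l \in L8 &
    forall P : {fset pic}, A1_polytope 4 P -> center P = D ->
      l \in P /\
      exists Q : {fset pic},
        unique (fun Q' : {fset pic} => cornered_A1_polytope 3 Q' /\ (Q' `<=` P)%fset) Q
        /\ center Q = D - l.
Proof.
move=> [P0 P0A P0D].
have [Q0 Q0c Q0P] := cornered_subpolytope P0A isT.
have [l [lP0 _ _ [r [rK rr rl rD]]]] := cornered_complement P0A Q0c Q0P.
have lL : l \in L8 by case: P0A => _ + _; apply.
(* [Q] ranges over all cornered quadruples of all polytopes with center [D], so
   this covers both the uniqueness of [Q] and that [l] does not depend on [P]. *)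
have common (P Q : {fset pic}) : A1_polytope 4 P -> center P = D ->
    cornered_A1_polytope 3 Q -> (Q `<=` P)%fset ->
    [/\ l \in P, Q = (P `\ l)%fset & center P = l + center Q].
  move=> PA PD Qc QP.
  have [l' [l'P QE PE [r' [r'K r'r' _ r'D]]]] := cornered_complement PA Qc QP.
  have l'L : l' \in L8 by case: PA => _ + _; apply.
  suff ll' : l = l' by rewrite ll'.
  apply: (addIr K); apply: (@root_sum_inj r (line_root l) r' (line_root l')) => //.
  - exact: dot_rootK.
  - exact: dot_root_self.
  - exact: dot_root_self.
  - by rewrite -rD -r'D P0D PD.
exists l => // P PA PD.
have [Q Qc QP] := cornered_subpolytope PA isT.
have [lP QE PE] := common P Q PA PD Qc QP.
split=> //; exists Q; split; last by rewrite -PD PE addrC addKr.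
split=> // Q' [Q'c Q'P].
by have [_ -> _] := common P Q' PA PD Q'c Q'P.
Qed.
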